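(* For a $k$-connected graph, the algorithm HDR-3-Bits (given in the context) is a $(k-1)$-resilient routing against semi-dynamic failures by rewriting at most $3$ bits in the packet headers.
   Context: A network is an undirected multigraph $G=(V,E)$; ''$k$-connected'' means $k$-edge-connected. Each edge $\{u,v\}$ gives two arcs $(u,v)$ and $(v,u)$. Semi-dynamic failures: a set $F\subseteq E$ of unstable links all of which are fail-stop, i.e. once a link of $F$ is down (in both directions) it stays down permanently; the links of $F$ need not fail simultaneously and may fail while a packet travels. Header-rewriting routing: each node $v\ne t$ has a predefined, static, deterministic forwarding function that chooses the outgoing link of a packet from the destination $t$, the in-port of the packet (or $\bot$ if the packet originates at $v$), the set of currently active links incident to $v$, and the values of some reserved rewritable bits in the packet header, which the function may also modify. The source of the packet is not used. A routing for destination $t$ is $r$-resilient against semi-dynamic failures if, for every set $F\subseteq E$ of semi-dynamic failures with $|F|\le r$, it routes a packet originated at a node $s\in V$ to $t$ as long as $s$ and $t$ are connected in $G\setminus F$ (the graph with all links of $F$ removed). Arborescences: an arborescence of $G$ rooted at $t$ is a directed spanning tree in which every node $v\neq t$ has a unique directed path to $t$. Arborescences are arc-disjoint if no two of them share an arc (they may share an edge, used in opposite directions). A $k$-connected graph has $k$ arc-disjoint arborescences rooted at any given $t$. Canonical routing along $T$ means following the directed path of $T$ to $t$. A failure $e=\{u,v\}$ hit on $T_i$ as the arc $(u,v)$ is shared by $T_j$, $j\ne i$, if $(v,u)$ is an arc of $T_j$; bouncing then means continuing from $u$ on $T_j$. DFS stands for depth-first search. Algorithm HDR-3-Bits (due to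 Chiesa et al.). Data: a set of $k$ arc-disjoint arborescences $\{T_1,\dots,T_k\}$ rooted at the destination $t$. Set $i:=1$. While the packet is not delivered to $t$: - route canonically along $T_i$ until reaching $t$ or hitting a failure $e\in F$; - if $e$ is shared by an arborescence $T_j$, $i\neq j$: bounce and route along the DFS traversal in $T_j$; if the routing hits a failure $e'\in F$ on $T_j$, route back to the failure $e$, to determine $T_i$, by reversing the DFS traversal on $T_j$; - set $i:=(i+1)\bmod k$. Arborescence indices are understood modulo $k$. *)

(* Defs.v *)
From mathcomp Require Import all_boot.

Set Implicit Arguments.
Unset Strict Implicit.
Unset Printing Implicit Defensive.

(** * Networks *)

(* The order of the two ends of a link carries no meaning. Loops are allowed
   (they can never belong to an arborescence). *)
Record multigraph := Multigraph {
  vertex : finType;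
  edge : finType;
  ends : edge -> vertex * vertex
}.

Section Network.
Variable G : multigraph.

(* The arc [(e, b)] is the link [e] oriented from its first to its second end
   if [b = false], and the other way round if [b = true]. *)
Definition arc_of : finType := (edge G * bool)%type.

Definition link (a : arc_of) : edge G := a.1.
Definition src (a : arc_of) : vertex G :=
  if a.2 then (ends a.1).2 else (ends a.1).1.
Definition dst (a : arc_of) : vertex G :=
  if a.2 then (ends a.1).1 else (ends a.1).2.
Definition flip (a : arc_of) : arc_of := (a.1, ~~ a.2).

Fixpoint walk (u : vertex G) (p : seq arc_of) (v : vertex G) : bool :=
  if p is a :: q then (src a == u) && walk (dst a) q v else u == v.

Definition linked (S : {set edge G}) (u v : vertex G) : Prop :=
  exists p : seq arc_of, walk u p v /\ {in p, forall a, link a \in S}.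

Definition k_edge_connected (k : nat) : Prop :=
  forall F : {set edge G}, #|F| < k -> forall u v, linked (~: F) u v.

(** * Arborescences *)

Definition spanning_tree (S : {set edge G}) : Prop :=
  (forall u v, linked S u v) /\
  (forall v p, walk v p v -> {in p, forall a, link a \in S} ->
     uniq (map link p) -> p = [::]).

Definition directed_path (T : {set arc_of}) (u : vertex G) (p : seq arc_of)
    (v : vertex G) : Prop :=
  [/\ walk u p v, {subset p <= T} & uniq (u :: map dst p)].

Definition arborescence (t : vertex G) (T : {set arc_of}) : Prop :=
  [/\ {in T &, injective link},
      spanning_tree [set link a | a in T]
    & forall v, v != t -> exists! p, directed_path T v p t].

Definition arc_disjoint (k : nat) (T : 'I_k -> {set arc_of}) : Prop :=
  forall i j, i != j -> [disjoint T i & T j].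

(* [dfs_tour T u L]: [L] is the sequence of arcs crossed by a depth-first
   search of the part of the arborescence [T] that hangs below [u], starting
   and ending at [u]. The arcs of [T] point towards the root, so that a child
   of [u] is the source of an arc of [T] with destination [u]; the children may
   be visited in any order [cs]. *)
Inductive dfs_tour (T : {set arc_of}) : vertex G -> seq arc_of -> Prop :=
| DfsTour (u : vertex G) (cs : seq arc_of) (L : arc_of -> seq arc_of) :
    uniq cs -> cs =i [pred c in T | dst c == u] ->
    (forall c, c \in cs -> dfs_tour T (src c) (L c)) ->
    dfs_tour T u (flatten [seq flip c :: rcons (L c) c | c <- cs]).

(** * Semi-dynamic failures and runs *)

(* [down n] is the set of links that are down when the packet is forwarded for
   the [n+1]-st time. *)
Definition semi_dynamic (F : {set edge G}) (down : nat -> {set edge G}) :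
    Prop :=
  (forall n, down n \subset F) /\ (forall n, down n \subset down n.+1).

(* A forwarding rule over packet states of type [S]: [step v p D x a y] means
   that a packet in state [x], located at [v] with in-port [p] ([None] if it
   originates at [v], otherwise the arc over which it arrived), leaves over the
   arc [a] in state [y] when [D] is the set of links that are down. *)
Definition rule (S : Type) : Type :=
  vertex G -> option arc_of -> {set edge G} -> S -> arc_of -> S -> Prop.

(* [run step t x0 down s n v p x]: a packet to [t] that originates at [s] in
   state [x0] is, after [n] hops, at [v] with in-port [p] and state [x]. It
   stops at [t]. *)
Inductive run (S : Type) (step : rule S) (t : vertex G) (x0 : S)
    (down : nat -> {set edge G}) (s : vertex G) :
    nat -> vertex G -> option arc_of -> S -> Prop :=
| RunStart : run step t x0 down s 0 s None x0
| RunHop n v p x a y :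
    run step t x0 down s n v p x -> v != t -> step v p (down n) x a y ->
    run step t x0 down s n.+1 (dst a) (Some a) y.

(** * Header-rewriting routing *)

Definition active_links (v : vertex G) (D : {set edge G}) : {set edge G} :=
  [set e | ((ends e).1 == v) || ((ends e).2 == v)] :\: D.

(* A routing towards a fixed destination, with [b] rewritable header bits:
   node, in-port, active incident links and header bits determine the outgoing
   arc and the new header bits; the value [None] means that the packet is
   dropped. *)
Definition routing (b : nat) : Type :=
  vertex G -> option arc_of -> {set edge G} -> b.-tuple bool ->
  option (arc_of * b.-tuple bool).

Definition routing_rule (b : nat) (R : routing b) : rule (b.-tuple bool) :=
  fun v p D h a h' =>
    [/\ R v p (active_links v D) h = Some (a, h'), src a = v
      & link a \in active_links v D].

(* The header bits of a new packet are all zero. *)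
Definition routing_run (b : nat) (R : routing b) (t : vertex G) :=
  run (routing_rule R) t (nseq_tuple b false).

Definition resilient (b : nat) (R : routing b) (t : vertex G) (r : nat) :
    Prop :=
  forall F : {set edge G}, #|F| <= r ->
  forall down, semi_dynamic F down ->
  forall s, linked (~: F) s t ->
  exists n p h, routing_run R t down s n t p h.

(** * HDR-3-Bits *)

(* [Canonical i]: follow [T i].
   [Forward j a]: follow the traversal of [T j] from the occurrence of [a] on;
   the packet is at [dst a].
   [Backward j a]: follow the traversal of [T j] in reverse, [a] being the arc
   to be undone next; the packet is at [dst a]. *)
Inductive hdr_state (k : nat) : Type :=
| Canonical of 'I_k
| Forward of 'I_k & arc_of
| Backward of 'I_k & arc_of.

Section HDR.
Variables (k : nat) (T : 'I_k -> {set arc_of}) (D : 'I_k -> seq arc_of).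

(* A packet that is sent back meets the failure from which it bounced, unless a
   link of the reversed route failed in the meantime. It cannot distinguish the
   two cases: it takes the first failure [link a] met on the way back for the
   one it bounced from, and continues after the index [i] of the other
   arborescence sharing it. If there is no such [i], the algorithm does not
   prescribe the next index, which is then given by [dflt]. *)
Variable dflt : 'I_k -> arc_of -> 'I_k.

(* The constructors without a hop change the state locally, at the node [v],
   until an active link is found. *)
Inductive hdr_rule (v : vertex G) (p : option arc_of) (X : {set edge G}) :
    hdr_state k -> arc_of -> hdr_state k -> Prop :=
| CanonicalHop i a :
    a \in T i -> src a = v -> link a \notin X ->
    hdr_rule v p X (Canonical i) a (Canonical i)
| CanonicalBounce i j a b y :
    a \in T i -> src a = v -> link a \in X ->
    j != i -> flip a \in T j ->
    hdr_rule v p X (Forward j (flip a)) b y ->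
    hdr_rule v p X (Canonical i) b y
| CanonicalSkip i a b y :
    a \in T i -> src a = v -> link a \in X ->
    (forall j, j != i -> flip a \notin T j) ->
    hdr_rule v p X (Canonical (ordS i)) b y ->
    hdr_rule v p X (Canonical i) b y
| ForwardHop j a :
    link (next (D j) a) \notin X ->
    hdr_rule v p X (Forward j a) (next (D j) a) (Forward j (next (D j) a))
| ForwardFail j a b y :
    link (next (D j) a) \in X ->
    hdr_rule v p X (Backward j a) b y ->
    hdr_rule v p X (Forward j a) b y
| BackwardHop j a :
    link a \notin X ->
    hdr_rule v p X (Backward j a) (flip a) (Backward j (prev (D j) a))
| BackwardFound j i a b y :
    link a \in X -> i != j -> flip a \in T i ->
    hdr_rule v p X (Canonical (ordS i)) b y ->
    hdr_rule v p X (Backward j a) b y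
| BackwardLost j a b y :
    link a \in X -> (forall i, i != j -> flip a \notin T i) ->
    hdr_rule v p X (Canonical (dflt j a)) b y ->
    hdr_rule v p X (Backward j a) b y.

Definition hdr_run (i1 : 'I_k) (t : vertex G) :=
  run hdr_rule t (Canonical i1).

(* [R] routes every packet over exactly the same links as HDR-3-Bits started
   with the arborescence of index [i1], whatever links go down. *)
Definition implements_hdr (b : nat) (R : routing b) (i1 : 'I_k)
    (t : vertex G) : Prop :=
  forall (down : nat -> {set edge G}) (s : vertex G) n v p,
    (exists x, hdr_run i1 t down s n v p x) <->
    (exists h, routing_run R t down s n v p h).

End HDR.
End Network.

(* Main.v *)
Require Import Defs.
From Stdlib Require Import Classical ClassicalEpsilon.
From mathcomp Require Import all_boot.

(** Every link of [F] that is down carries two arcs, so with [#|F| < k] there are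
    fewer than [2 k] arcs on down links. Hence some arborescence [T i] is good: each
    of its failures is shared with a [T j] whose depth-first traversal meets no
    failure after it, and bouncing from it delivers the packet. Any other bounce
    either delivers the packet or brings it back to the failure and then to the
    next index, so under static failures the good index is eventually tried.
    Semi-dynamic failures reduce to static ones: the set of down links grows
    only finitely often, and after each growth the packet is still in a state
    from which it is delivered if no further link fails.

    Three bits are enough because the in-port fixes everything else: an arc [a]
    is traversed for the sake of the arborescence containing [a] or of the one
    containing [flip a], in one of the three modes. *)

Set Implicit Arguments.
Unset Strict Implicit.
Unset Printing Implicit Defensive.

(** * Sequences and cyclic neighbours *)

Lemma flatten_map_uniq (A B : eqType) (f : A -> seq B) (s : seq A) :
  uniq s -> {in s, forall x, uniq (f x)} ->
  (forall x y z, x \in s -> y \in s -> z \in f x -> z \in f y -> x = y) ->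
  uniq (flatten [seq f x | x <- s]).
Proof.
elim: s => //= x s IH /andP[xs s_uniq] f_uniq f_inj.
have sub y : y \in s -> y \in x :: s by rewrite inE orbC => ->.
rewrite cat_uniq f_uniq ?mem_head //=; apply/andP; split.
  apply/negP => /hasP [z /flatten_mapP [y ys zy] zx].
  by rewrite (f_inj x y z (mem_head _ _) (sub _ ys) zx zy) ys in xs.
apply: IH => // [y /sub|y y' z /sub h /sub]; [exact: f_uniq|exact: f_inj].
Qed.

Section Cycle.
Variables (A : eqType) (L1 L2 : seq A) (a b : A).
Hypothesis L_uniq : uniq (L1 ++ a :: b :: L2).

Lemma next_cat : next (L1 ++ a :: b :: L2) a = b.
Proof.
by rewrite -(next_rot (size L1) L_uniq) rot_size_cat /= eqxx.
Qed.

Lemma prev_cat : prev (L1 ++ a :: b :: L2) b = a.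
Proof. by have := prev_next L_uniq a; rewrite next_cat. Qed.

End Cycle.

Lemma last_has_split (A : Type) (P : pred A) (s : seq A) : has P s ->
  exists s1 x s2, [/\ s = s1 ++ x :: s2, P x & all (predC P) s2].
Proof.
elim/last_ind: s => // s x IH; rewrite has_rcons.
case Px: (P x) => /=; first by exists s, x, [::]; rewrite cats1.
case/IH=> s1 [y [s2 [-> Py h]]]; exists s1, y, (rcons s2 x).
by rewrite rcons_cat all_rcons h /= Px.
Qed.

(** * Arcs and walks *)

Section Arcs.
Variable G : multigraph.
Implicit Types (u v w : vertex G) (a b c : arc_of G) (p q : seq (arc_of G)).

Lemma flipK : involutive (@flip G).
Proof. by case=> e []. Qed.

Lemma src_flip a : src (flip a) = dst a.
Proof. by case: a => e []. Qed.

Lemma dst_flip a : dst (flip a) = src a.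
Proof. by case: a => e []. Qed.

Lemma link_flip a : link (flip a) = link a.
Proof. by []. Qed.

Lemma flip_neq a : flip a != a.
Proof. by case: a => e []; rewrite /flip xpair_eqE /= andbF. Qed.

Lemma walk_cat u p q w :
  walk u (p ++ q) w <-> exists2 v, walk u p v & walk v q w.
Proof.
elim: p u => [|a p IH] u /=.
  by split=> [h|[v /eqP -> //]]; exists u.
split=> [/andP[-> /IH [v h1 h2]]|[v /andP[-> h1] h2]]; first by exists v.
by apply/IH; exists v.
Qed.

Lemma walk_rcons u p a w :
  walk u (rcons p a) w = walk u p (src a) && (dst a == w).
Proof. by elim: p u => [|b p IH] u /=; rewrite ?IH ?andbA // eq_sym. Qed.

Lemma walk_path u v a q :
  walk u (a :: q) v =
  [&& src a == u, path (fun b c => dst b == src c) a q & dst (last a q) == v].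
Proof.
elim: q u a => [|b q IH] u a //; rewrite -[walk u _ v]/((_ == _) && walk _ (b :: q) v).
by rewrite IH /= [src b == _]eq_sym -!andbA.
Qed.

End Arcs.

(** * Arborescences and their depth-first traversals *)

Section Arborescence.
Variables (G : multigraph) (t : vertex G) (T : {set arc_of G}).
Hypothesis T_arb : arborescence t T.
Implicit Types (u v w : vertex G) (a b c : arc_of G) (p q : seq (arc_of G)).

Lemma arborescence_flip a : a \in T -> flip a \notin T.
Proof.
case: T_arb => inj _ _ aT; apply/negP => faT.
by move/eqP: (inj _ _ faT aT (link_flip a)); apply/negP/flip_neq.
Qed.

Lemma directed_path_root p : directed_path T t p t -> p = [::].
Proof.
case: (lastP p) => // q a [+ _]; rewrite walk_rcons => /andP[_ /eqP dat] /=.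
by rewrite map_rcons mem_rcons inE dat eqxx.
Qed.

Lemma directed_path_unique v p q :
  directed_path T v p t -> directed_path T v q t -> p = q.
Proof.
case: (eqVneq v t) => [->|vt hp hq].
  by move=> /directed_path_root -> /directed_path_root ->.
case: T_arb => _ _ /(_ _ vt) [r [_ r_uniq]].
by rewrite -(r_uniq _ hp) -(r_uniq _ hq).
Qed.

Lemma directed_path_exists v : exists p, directed_path T v p t.
Proof.
case: (eqVneq v t) => [->|vt]; first by exists [::]; split=> //=; rewrite eqxx.
by case: T_arb => _ _ /(_ _ vt) [r [? _]]; exists r.
Qed.

(** If the new start already lay on the path, [c] and a prefix of the path would close a cycle of
    distinct links in the spanning tree. *)
Lemma directed_path_cons c p :
  c \in T -> directed_path T (dst c) p t -> directed_path T (src c) (c :: p) t.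
Proof.
move=> cT [wp pT up]; split=> [||]; first by rewrite /= eqxx.
  by move=> a; rewrite inE => /predU1P[-> //|/pT].
rewrite [map _ _]/= cons_uniq up andbT; apply/negP => csrc.
have [p1 [p2 [Ep w1]]] : exists p1 p2, p = p1 ++ p2 /\ walk (dst c) p1 (src c).
  move: csrc wp; rewrite inE => /predU1P[e _|].
    by exists [::], p; split=> //=; rewrite e.
  case/mapP=> a /splitPr [q1 q2] e; rewrite -cat_rcons => /walk_cat [w h _].
  exists (rcons q1 a), q2; split=> //; move: h.
  by rewrite e !walk_rcons eqxx andbT => /andP[->].
case: T_arb => inj [_ acyclic] _.
have sT : {subset c :: p1 <= T}.
  move=> a; rewrite inE => /predU1P[-> //|h]; apply: pT.
  by rewrite Ep mem_cat h.
suff : c :: p1 = [::] by [].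
apply: (acyclic (src c)); first by rewrite /= eqxx.
  by move=> a /sT aT; apply: imset_f.
rewrite map_inj_in_uniq; last by move=> a b /sT ? /sT ?; apply: inj.
apply: (@map_uniq _ _ (@dst G)).
by move: up; rewrite Ep map_cat -cat_cons cat_uniq => /andP[].
Qed.

Lemma directed_path_cat u q v p : walk u q v -> {subset q <= T} ->
  directed_path T v p t -> directed_path T u (q ++ p) t.
Proof.
elim: q u => [|a q IH] u /=; first by move=> /eqP ->.
case/andP=> /eqP <- w sT hp; apply: directed_path_cons.
  by apply: sT; rewrite mem_head.
by apply: IH => // b h; apply: sT; rewrite inE h orbT.
Qed.

(** Extended by the path from [v] to the root, both walks become directed paths from [u] and
    coincide; reversal lets the common tail cancel. *)
Lemma walk_unique u v p q : walk u p v -> {subset p <= T} ->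
  walk u q v -> {subset q <= T} -> p = q.
Proof.
move=> wp pT wq qT; have [r hr] := directed_path_exists v.
have /(congr1 (fun s => rev s)) := directed_path_unique
  (directed_path_cat wp pT hr) (directed_path_cat wq qT hr).
move/eqP; rewrite !rev_cat eqseq_cat // eqxx /=.
by move/eqP/(congr1 rev); rewrite !revK.
Qed.

Lemma out_arc_unique a b : a \in T -> b \in T -> src a = src b -> a = b.
Proof.
move=> aT bT e.
have [p hp] := directed_path_exists (dst a).
have [q hq] := directed_path_exists (dst b).
have hp' := directed_path_cons aT hp; have hq' := directed_path_cons bT hq.
by rewrite e in hp'; case: (directed_path_unique hp' hq').
Qed.

End Arborescence.

(** * Depth-first tours *)

Section Tour.
Variables (G : multigraph) (t : vertex G) (T : {set arc_of G}).
Hypothesis T_arb : arborescence t T.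
Implicit Types (u v w : vertex G) (a b c : arc_of G) (p q L : seq (arc_of G)).

Lemma dfs_tour_walk u L : dfs_tour T u L -> walk u L u.
Proof.
elim=> {L}{}u cs L _ cs_def _ IH.
have : {subset cs <= [pred c in T | dst c == u]} by move=> c; rewrite cs_def.
elim: cs {cs_def} IH => [|c cs IHcs] IH sub //=.
have /andP[_ /eqP dc] := sub c (mem_head _ _).
rewrite src_flip dc eqxx dst_flip /= cat_rcons; apply/walk_cat.
exists (src c); first by apply: IH; rewrite mem_head.
rewrite /= eqxx dc; apply: IHcs => b h; last by apply: sub; rewrite inE h orbT.
by apply: IH; rewrite inE h orbT.
Qed.

(** Arcs point towards the root: [a] lies in the subtree hanging from [u]. *)
Definition below u a := exists2 p, walk (src a) (a :: p) u & {subset a :: p <= T}.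

Lemma dfs_tour_below u L a :
  dfs_tour T u L -> a \in L -> below u a \/ below u (flip a).
Proof.
move=> h; elim: h a => {L}{}u cs L _ cs_def _ IH a /flatten_mapP [c ccs].
have /andP[cT /eqP dc] : c \in [pred c in T | dst c == u] by rewrite -cs_def.
have self : below u c.
  exists [::]; first by rewrite /= dc !eqxx.
  by move=> b; rewrite inE => /eqP ->.
have step b : below (src c) b -> below u b.
  case=> p w sT; exists (rcons p c).
    by rewrite -rcons_cons walk_rcons w dc /=.
  move=> x; rewrite -rcons_cons mem_rcons inE => /predU1P[-> //|]; exact: sT.
rewrite inE mem_rcons inE => /or3P[/eqP ->|/eqP ->|/(IH _ ccs)].
- by right; rewrite flipK.
- by left.
by case=> /step; auto.
Qed.

(** A subtree is entered over [flip a], toured, and only then left over [a]. *)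
Lemma dfs_tour_split u L a : dfs_tour T u L -> below u a ->
  exists L1 L2 L3, L = L1 ++ flip a :: L2 ++ a :: L3.
Proof.
move=> h [p]; elim: h p => {L}{}u cs L _ cs_def _ IH p w sT.
have block c : c \in cs -> exists M1 M2,
    flatten [seq flip c :: rcons (L c) c | c <- cs] =
      M1 ++ (flip c :: L c ++ c :: M2).
  case/splitPr=> c1 c2; rewrite map_cat flatten_cat /= cat_rcons.
  by eexists; eexists; rewrite -?cat_cons; reflexivity.
case: (lastP p) w sT => [|q c].
  rewrite /= eqxx => /= da sT; have acs : a \in cs.
    by rewrite cs_def inE da sT ?mem_head.
  by have [M1 [M2 ->]] := block a acs; exists M1, (L a), M2.
rewrite -rcons_cons walk_rcons => /andP[w dc] sT.
have ccs : c \in cs by rewrite cs_def inE dc sT // mem_rcons mem_head.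
have [|L1 [L2 [L3 E]]] := IH c ccs q w.
  by move=> b h; apply: sT; rewrite mem_rcons inE h orbT.
have [M1 [M2 ->]] := block c ccs; rewrite E.
exists (M1 ++ flip c :: L1), L2, (L3 ++ c :: M2).
by repeat rewrite -catA /=.
Qed.

Lemma below_T u a : below u a -> a \in T.
Proof. by case=> p _; apply; rewrite mem_head. Qed.

Lemma not_below_src a : ~ below (src a) a.
Proof. case=> p w sT; suff : a :: p = [::] by [].
by apply: (walk_unique T_arb w sT) => //=. Qed.

Definition via u c a :=
  exists2 q, walk (src a) (rcons q c) u & {subset rcons q c <= T}.

(* Walks of [T] between two given nodes are unique, so they have the same last
   arc. *)
Lemma via_unique u a c c' : via u c a -> via u c' a -> c = c'.
Proof.
case=> [q w sT] [q' w' sT'].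
by have /rcons_inj [] := walk_unique T_arb w sT w' sT'.
Qed.

(** Blocks of different children are disjoint, as an arc determines the child arc through which it
    hangs; inside a block, the child arc cannot reappear below its own source. *)
Lemma dfs_tour_uniq u L : dfs_tour T u L -> uniq L.
Proof.
elim=> {L}{}u cs L cs_uniq cs_def tours IH.
have sub c : c \in cs -> c \in T /\ dst c = u.
  by rewrite cs_def => /andP[? /eqP].
have notT a : a \in T -> flip a \in T -> False.
  by move=> /(arborescence_flip T_arb) /negP.
apply: flatten_map_uniq => // [c ccs|c c' a ccs c'cs].
  rewrite cons_uniq rcons_uniq mem_rcons inE negb_or (IH _ ccs) flip_neq andbT /=.
  have cT := (sub _ ccs).1.
  apply/andP; split; apply/negP => /(dfs_tour_below (tours _ ccs)).
    by rewrite flipK => -[/below_T /(notT _ cT)|/not_below_src].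
  by case=> [/not_below_src|/below_T /(notT _ cT)].
have blockP d b : d \in cs -> b \in flip d :: rcons (L d) d ->
    b \in T /\ via u d b \/ flip b \in T /\ via u d (flip b).
  move=> dcs; have [dT dd] := sub _ dcs.
  have self : d \in T /\ via u d d.
    split=> //; exists [::]; first by rewrite /= dd !eqxx.
    by move=> x; rewrite inE => /eqP ->.
  have deep x : below (src d) x -> x \in T /\ via u d x.
    case=> p w sT; split; first by apply: sT; rewrite mem_head.
    exists (x :: p); first by rewrite walk_rcons w dd /=.
    by move=> y; rewrite mem_rcons inE => /predU1P[-> //|/sT].
  rewrite inE mem_rcons inE => /or3P[/eqP ->|/eqP ->|].
  - by rewrite flipK; right.
  - by left.
  by case/(dfs_tour_below (tours _ dcs)) => /deep; auto.
move=> /(blockP _ _ ccs) [] [aT h] /(blockP _ _ c'cs) [] [aT' h'];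
  try by [case: (notT a)]; exact: via_unique h h'.
Qed.

Lemma below_root a : a \in T -> below t a.
Proof.
move=> aT; have [p [w sT _]] := directed_path_exists T_arb (dst a).
exists p; first by rewrite /= eqxx.
by move=> x; rewrite inE => /predU1P[-> //|/sT].
Qed.

End Tour.

(** * Runs of HDR-3-Bits *)

Section HDR.
Variables (G : multigraph) (k : nat) (t : vertex G).
Variables (T : 'I_k -> {set arc_of G}) (D : 'I_k -> seq (arc_of G)).
Variable dflt : 'I_k -> arc_of G -> 'I_k.
Hypothesis T_arb : forall i, arborescence t (T i).
Hypothesis T_disj : arc_disjoint T.
Hypothesis D_dfs : forall i, dfs_tour (T i) t (D i).
Implicit Types (u v w : vertex G) (a b c : arc_of G) (L : seq (arc_of G)).
Implicit Types (X Y F : {set edge G}) (i j : 'I_k) (x y : hdr_state G k).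

Local Notation step := (hdr_rule T D dflt).

Lemma tour_uniq j : uniq (D j).
Proof. exact: dfs_tour_uniq (T_arb j) _ _ (D_dfs j). Qed.

Lemma mem_tour j a : (a \in D j) = (a \in T j) || (flip a \in T j).
Proof.
apply/idP/orP => [/(dfs_tour_below (D_dfs j)) [] /below_T|]; auto.
have split_mem c : c \in T j -> c \in D j /\ flip c \in D j.
  move=> /(below_root (T_arb j)) /(dfs_tour_split (D_dfs j)).
  by case=> L1 [L2 [L3 ->]]; rewrite !(mem_cat, inE) !eqxx !orbT.
by case=> /split_mem [] //; rewrite flipK.
Qed.

Lemma tour_split j a : a \in D j -> exists L1 L2, D j = L1 ++ a :: L2.
Proof. by case/splitPr => L1 L2; exists L1, L2. Qed.

(** As the tour is closed, the cyclic [next] and [prev] match end points even across its two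
    ends. *)
Lemma tour_cycle j : cycle (fun b c => dst b == src c) (D j).
Proof.
have := dfs_tour_walk (D_dfs j); case: (D j) => // a L; rewrite walk_path.
by case/and3P=> /eqP sa p /eqP da; rewrite /= rcons_path p /= da sa.
Qed.

Lemma dst_tour_last j L a : D j = rcons L a -> dst a = t.
Proof.
by move=> E; have := dfs_tour_walk (D_dfs j); rewrite E walk_rcons => /andP[_ /eqP].
Qed.

Lemma src_next_tour j a : a \in D j -> src (next (D j) a) = dst a.
Proof. by move=> /(next_cycle (tour_cycle j)) /eqP. Qed.

Lemma dst_prev_tour j a : a \in D j -> dst (prev (D j) a) = src a.
Proof. by move=> /(prev_cycle (tour_cycle j)) /eqP. Qed.

Lemma next_mem_tour j a : a \in D j -> next (D j) a \in D j.
Proof. by rewrite mem_next. Qed.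

Lemma arborescence_unique i j a : a \in T i -> a \in T j -> i = j.
Proof.
by move=> ai; apply: contraTeq => /T_disj /disjointFr ->.
Qed.

(** * Counting failures *)

(** A packet resuming the tour after [a] reaches [t] if exactly the links of [X] are down. *)
Definition last_down X j a := exists L1 L2,
  [/\ D j = L1 ++ a :: L2, link a \in X & {in L2, forall b, link b \notin X}].

(* A link is crossed downwards before it is crossed upwards. *)
Lemma last_down_upwards X j a :
  a \in T j -> link a \in X -> exists2 l, l \in T j & last_down X j l.
Proof.
move=> aT aX; have : has (fun b => link b \in X) (D j).
  by apply/hasP; exists a; rewrite // mem_tour aT.
case/last_has_split => L1 [l [L2 [E lX /allP liveL2]]].
exists l; last by exists L1, L2.
have : l \in D j by rewrite E mem_cat mem_head orbT.
rewrite mem_tour => /orP[//|flT].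
have [M1 [M2 [M3]]] := dfs_tour_split (D_dfs j) (below_root (T_arb j) flT).
rewrite flipK => E'; have := tour_uniq j; rewrite E => U.
suff E2 : L2 = M2 ++ flip l :: M3.
  have : flip l \in L2 by rewrite E2 mem_cat mem_head orbT.
  by move/liveL2 => /= /negP [].
have E1 : L1 = M1.
  have lL1 : l \notin L1.
    by move: U; rewrite cat_uniq => /and3P[_ /norP[]].
  have lM1 : l \notin M1.
    by have := tour_uniq j; rewrite E' cat_uniq => /and3P[_ /norP[]].
  have := congr1 (index l) (etrans (esym E) E').
  rewrite !index_cat (negPf lL1) (negPf lM1) /= eqxx !addn0 => s.
  have := congr1 (take (size L1)) (etrans (esym E) E').
  by rewrite take_size_cat // s take_size_cat.
by move: E'; rewrite E E1 => /eqP; rewrite eqseq_cat // eqxx => /eqP [].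
Qed.

Definition good X i := forall a, a \in T i -> link a \in X ->
  exists j, [/\ j != i, flip a \in T j & last_down X j (flip a)].

(* If every [T i] had a down arc [f i] refuting [good X i], the [k] arcs [f i]
   and the flips of the [k] arcs that come last among the down arcs of a tour
   would be [2 k] different orientations of the links in [X]. *)
Lemma good_exists X : #|X| < k -> exists i, good X i.
Proof.
move=> Xk; apply: NNPP => no_good.
have bad i : exists a, [/\ a \in T i, link a \in X &
    forall j, j != i -> flip a \in T j -> ~ last_down X j (flip a)].
  apply: NNPP => none; apply: no_good; exists i => a aT aX.
  apply: NNPP => h; apply: none; exists a; split=> // j ji jT lj.
  by apply: h; exists j.
have [f fP] := fin_all_exists bad.
have lasts i : exists l, l \in T i /\ last_down X i l.
  by case: (fP i) => aT aX _; have [l lT h] := last_down_upwards aT aX; exists l.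
have [l lP] := fin_all_exists lasts.
pose g (z : 'I_k + 'I_k) := match z with inl i => f i | inr i => flip (l i) end.
(* For [j = i], equality puts both orientations of an arc in [T i]; for [j != i], it makes [f i] a
   failure shared with [T j] whose flip comes last there, against the choice of [f i]. *)
have fl i j : f i <> flip (l j).
  move=> e; case: (fP i) => fT fX; case: (lP j) => lT lj.
  have /eqP : flip (f i) = l j by rewrite e flipK.
  case: (eqVneq j i) => [ji|ji] /eqP e' h.
    by move: (arborescence_flip (T_arb i) fT); rewrite e' -ji lT.
  by apply: (h j ji); rewrite e'.
have g_inj : injective g.
  case=> i [] j //= e.
  - case: (fP i) (fP j) => h _ _ [h' _ _]; rewrite -e in h'.
    by rewrite (arborescence_unique h h').
  - by case: (fl _ _ e).
  - by case: (fl _ _ (esym e)).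
  - case: (lP i) (lP j) => h _ [h' _]; rewrite -(inv_inj (@flipK G) e) in h'.
    by rewrite (arborescence_unique h h').
have : g @: setT \subset setX X [set: bool].
  apply/subsetP => _ /imsetP [z _ ->].
  have -> : (g z \in setX X [set: bool]) = (link (g z) \in X).
    by case: (g z) => e b; rewrite in_setX inE andbT.
  case: z => i /=; first by case: (fP i).
  by case: (lP i) => _ [? [? []]].
move/subset_leq_card; rewrite (card_imset _ g_inj) cardsX !cardsT card_bool.
by rewrite card_sum !card_ord addnn -muln2 leq_pmul2r // leqNgt Xk.
Qed.

(** * Delivery under static failures *)

(** The set [X] is frozen. Each hop must be allowed for every in-port, so that the in-port stays out
    of the induction. *)
Inductive delivers X : vertex G -> hdr_state G k -> Prop :=
| DeliversStop x : delivers X t x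
| DeliversHop v x a y : v != t ->
    (forall p, step v p X x a y) -> delivers X (dst a) y -> delivers X v x.

Lemma delivers_local X v x x' :
  (forall p a y, step v p X x' a y -> step v p X x a y) ->
  delivers X v x' -> delivers X v x.
Proof.
move=> sub; case: (eqVneq v t) => [-> _|vt h]; first exact: DeliversStop.
case: h vt sub => [? /eqP //|{}v x0 a y _ h d vt sub].
by apply: DeliversHop d => // p; apply: sub.
Qed.

Lemma delivers_hop X v x a y :
  (forall p, step v p X x a y) -> delivers X (dst a) y -> delivers X v x.
Proof.
case: (eqVneq v t) => [->|vt h]; first by move=> *; exact: DeliversStop.
exact: DeliversHop.
Qed.

Lemma delivers_forward_live X j L1 a L2 : D j = L1 ++ a :: L2 ->
  {in L2, forall b, link b \notin X} -> delivers X (dst a) (Forward j a).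
Proof.
elim: L2 L1 a => [|b L2 IH] L1 a E live.
  by rewrite (@dst_tour_last j L1 a) ?E ?cats1 //; exact: DeliversStop.
have nE : next (D j) a = b by have := tour_uniq j; rewrite E; apply: next_cat.
apply: (@delivers_hop _ _ _ b (Forward j b)).
  by move=> p; rewrite -nE; apply: ForwardHop; rewrite nE live ?mem_head.
apply: (IH (rcons L1 a)); first by rewrite cat_rcons.
by move=> c h; apply: live; rewrite inE h orbT.
Qed.

(** The rest of the tour either leads to [t] or is cut by a failure; then the arcs crossed
    meanwhile, all of them up, are undone one by one back to [a]. *)
Lemma delivers_forward X j L1 a L2 : D j = L1 ++ a :: L2 ->
  delivers X (dst a) (Backward j a) -> delivers X (dst a) (Forward j a).
Proof.
elim: L2 L1 a => [|b L2 IH] L1 a E back.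
  by rewrite (@dst_tour_last j L1 a) ?E ?cats1 //; exact: DeliversStop.
have [nE pE] : next (D j) a = b /\ prev (D j) b = a.
  by have := tour_uniq j; rewrite E => U; rewrite next_cat // prev_cat.
have sb : src b = dst a by rewrite -nE src_next_tour // E mem_cat mem_head orbT.
case: (boolP (link b \in X)) => bX.
  apply: delivers_local back => p c y; apply: ForwardFail; by rewrite nE.
apply: (@delivers_hop _ _ _ b (Forward j b)).
  by move=> p; rewrite -nE; apply: ForwardHop; rewrite nE.
apply: (IH (rcons L1 a)); first by rewrite cat_rcons.
apply: (@delivers_hop _ _ _ (flip b) (Backward j a)).
  by move=> p; rewrite -[in X in step _ _ _ _ _ X]pE; apply: BackwardHop.
by rewrite dst_flip sb.
Qed.

Lemma delivers_canonical_path X i :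
  (forall v a, a \in T i -> src a = v -> link a \in X ->
     delivers X v (Canonical _ i)) ->
  forall v, delivers X v (Canonical _ i).
Proof.
move=> down v; have [q [w sT _]] := directed_path_exists (T_arb i) v.
elim: q v w sT => [|a q IH] v /=; first by move=> /eqP -> _; exact: DeliversStop.
case/andP=> /eqP av w sT; have aT : a \in T i by apply: sT; rewrite mem_head.
case: (boolP (link a \in X)) => aX; first exact: down aX.
apply: (@delivers_hop _ _ _ a (Canonical _ i)); first by move=> p; apply: CanonicalHop.
by apply: IH => // b h; apply: sT; rewrite inE h orbT.
Qed.

Lemma delivers_good X i : good X i -> forall v, delivers X v (Canonical _ i).
Proof.
move=> gi; apply: delivers_canonical_path => v a aT av aX.
have [j [ji jT [L1 [L2 [E _ live]]]]] := gi a aT aX.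
apply: (@delivers_local _ _ _ (Forward j (flip a))).
  by move=> p b y; exact: CanonicalBounce.
by rewrite -av -dst_flip; apply: delivers_forward_live E live.
Qed.

(** An unshared failure is skipped at once. From a shared one, a bounce that does not deliver
    returns to [flip a]; the arborescence containing [a] is recognised as [T i], and the next index
    is tried. *)
Lemma delivers_next X i : (forall v, delivers X v (Canonical _ (ordS i))) ->
  forall v, delivers X v (Canonical _ i).
Proof.
move=> dS; apply: delivers_canonical_path => v a aT av aX.
case: (pickP (fun j => (j != i) && (flip a \in T j))) => [j /andP[ji jT]|none].
  apply: (@delivers_local _ _ _ (Forward j (flip a))).
    by move=> p b y; exact: CanonicalBounce.
  have : flip a \in D j by rewrite mem_tour jT.
  move=> /tour_split [L1 [L2 E]]; rewrite -av -dst_flip.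
  apply: delivers_forward E _; apply: delivers_local (dS _) => p b y.
  by apply: BackwardFound; rewrite ?flipK // eq_sym.
apply: delivers_local (dS v) => p b y; apply: CanonicalSkip aT av aX _.
by move=> j ji; have := none j; rewrite ji /= => ->.
Qed.

Lemma delivers_canonical X i v : #|X| < k -> delivers X v (Canonical _ i).
Proof.
move=> /good_exists [i0 gi0].
have [m Em] : exists m, iter m (@ordS k) i = i0.
  (* Modulo [k], this many steps lead from [i] to [i0]; the summand [k] prevents truncated
     subtraction. *)
  exists (i0 + k - i); apply: val_inj.
  have -> m : \val (iter m (@ordS k) i) = (i + m) %% k.
    elim: m => [|m IH]; first by rewrite addn0 modn_small.
    rewrite iterS /= -[nat_of_ord _]/(val (iter m (@ordS k) i)) IH.
    by rewrite -addn1 modnDml addn1 addnS.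
  rewrite subnKC; last by rewrite ltnW // ltn_addl.
  by rewrite modnDr modn_small.
elim: m i Em v => [|m IH] i /=; first by move=> ->; apply: delivers_good.
by rewrite -iterS iterSr => Em; apply: delivers_next => w; apply: IH.
Qed.

(* The down link behind a bounced packet stops it on the way back, before the
   traversal is undone beyond its start. *)
Definition valid X v x : Prop :=
  match x with
  | Canonical _ => True
  | Forward j a | Backward j a =>
      dst a = v /\ exists L1 L2,
        D j = L1 ++ a :: L2 /\ has (fun b => link b \in X) (rcons L1 a)
  end.

(** Validity guarantees a down link on the way back. At the first one met, whether or not it is the
    original failure, the packet turns canonical for some index, and every index delivers. *)
Lemma delivers_valid X v x : #|X| < k -> valid X v x -> delivers X v x.
Proof.
move=> Xk.
have found w j a : link a \in X -> delivers X w (Backward j a).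
  move=> aX.
  case: (pickP (fun i => (i != j) && (flip a \in T i))) => [i /andP[ij iT]|none].
    apply: delivers_local (delivers_canonical (ordS i) _ Xk) => p b y.
    exact: BackwardFound.
  apply: delivers_local (delivers_canonical (dflt j a) _ Xk) => p b y.
  by apply: BackwardLost aX _ => i ij; have := none i; rewrite ij /= => ->.
have back j a L1 L2 : D j = L1 ++ a :: L2 ->
    has (fun b => link b \in X) (rcons L1 a) ->
    delivers X (dst a) (Backward j a).
  elim/last_ind: L1 a L2 => [|L1 c IH] a L2 E; rewrite has_rcons.
    by rewrite orbF; apply: found.
  case: (boolP (link a \in X)) => [aX _|aX /= hX]; first exact: found.
  rewrite cat_rcons in E.
  have pE : prev (D j) a = c by have := tour_uniq j; rewrite E; apply: prev_cat.
  apply: (@delivers_hop _ _ _ (flip a) (Backward j c)).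
    by move=> p; rewrite -pE; apply: BackwardHop.
  rewrite dst_flip -(@dst_prev_tour j a) ?pE; first exact: IH E hX.
  by rewrite E mem_cat !inE eqxx !orbT.
case: x => [i _|j a|j a]; first exact: delivers_canonical.
  case=> <- [L1 [L2 [E hX]]]; apply: delivers_forward (E) _; exact: back E hX.
by case=> <- [L1 [L2 [E hX]]]; apply: back E hX.
Qed.

(** * Passage to semi-dynamic failures *)

Lemma valid_mono X Y v x : X \subset Y -> valid X v x -> valid Y v x.
Proof.
move=> /subsetP sXY; case: x => //= j a [? [L1 [L2 [E hX]]]];
  by split=> //; exists L1, L2; split=> //; apply: sub_has hX => b; apply: sXY.
Qed.

Lemma valid_step X v p x a y :
  v != t -> step v p X x a y -> valid X v x -> valid X (dst a) y.
Proof.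
move=> vt; elim=> {x a y} //.
- move=> i j a b y aT av aX ji jT _ IH _; apply: IH; split; first by rewrite dst_flip.
  have : flip a \in D j by rewrite mem_tour jT.
  move=> /tour_split [L1 [L2 E]]; exists L1, L2; split=> //.
  by rewrite has_rcons link_flip aX.
(* Were [a] the last arc of the tour, the packet would be at [t]; hence [next] does not wrap
   around. *)
- move=> j a _ [av [L1 [[|b L2] [E hX]]]].
    by move: vt; rewrite -av (@dst_tour_last j L1 a) ?E ?cats1 // eqxx.
  have -> : next (D j) a = b by have := tour_uniq j; rewrite E; apply: next_cat.
  split=> //; exists (rcons L1 a), L2; split; first by rewrite cat_rcons.
  by rewrite has_rcons hX orbT.
(* As [a] is up, the down link lies strictly before it, and [prev] does not wrap around. *)
- move=> j a aX [av [L1 [L2 [E]]]]; rewrite has_rcons (negPf aX) /=.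
  case/lastP: L1 E => // L1 c; rewrite cat_rcons => E hX.
  have pE : prev (D j) a = c by have := tour_uniq j; rewrite E; apply: prev_cat.
  split; last by rewrite pE; exists L1, (a :: L2).
  by rewrite dst_flip dst_prev_tour // E mem_cat !inE eqxx !orbT.
- by move=> j i a b y _ _ _ _ IH _; apply: IH.
- by move=> j a b y _ _ _ IH _; apply: IH.
Qed.

(** Outer induction on the number of links of [F] still up, inner induction on delivery under the
    current down set. While that set is unchanged the inner induction advances; once it grows,
    validity survives and the outer one applies. *)
Lemma hdr_run_delivered (i1 : 'I_k) F (down : nat -> {set edge G}) s :
  #|F| < k -> semi_dynamic F down ->
  exists n p x, hdr_run T D dflt i1 t down s n t p x.
Proof.
move=> Fk [downF down_mono].
have down_k n : #|down n| < k by apply: leq_ltn_trans (subset_leq_card (downF n)) Fk.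
have less n : down n.+1 != down n -> #|F :\: down n.+1| < #|F :\: down n|.
  move=> ne; rewrite !cardsDS // ltn_sub2lE ?subset_leq_card //.
  by rewrite proper_card // properEneq eq_sym ne down_mono.
suff progress m n v p x : #|F :\: down n| <= m ->
    hdr_run T D dflt i1 t down s n v p x -> valid (down n) v x ->
    exists n' p' x', hdr_run T D dflt i1 t down s n' t p' x'.
  exact: progress (leqnn _) (RunStart _ _ _ _ _) _.
elim: m n v p x => [|m IHm] n v p x le_m r val.
all: have d := delivers_valid (down_k n) val; move EX: (down n) d => X d.
all: elim: d n p EX le_m r val => {v x} [x|v x a y vt hop _ IHd] n p EX le_m r val;
  first by exists n, p, x.
all: have hopn : step v p (down n) x a y by rewrite EX.
all: have r' := RunHop r vt hopn.
all: have val' := valid_mono (down_mono n) (valid_step vt hopn val).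
all: case: (eqVneq (down n.+1) (down n)) => [En|ne];
  first by apply: IHd r' val' => //; rewrite En.
all: have {}le_m := leq_trans (less n ne) le_m.
- by rewrite ltn0 in le_m.
- exact: IHm r' val'.
Qed.

(** * Locality and determinism of the rule *)

(** Unlike [valid], this mentions no failures, so it persists for arbitrary sequences of down sets,
    as [implements_hdr] requires. *)
Definition local v x : Prop :=
  match x with
  | Canonical _ => True
  | Forward j a | Backward j a => a \in D j /\ dst a = v
  end.

Lemma local_bounce v a j : src a = v -> flip a \in T j -> local v (Forward j (flip a)).
Proof. by move=> av jT; rewrite /= mem_tour jT dst_flip. Qed.

Lemma step_local X v p x a y : step v p X x a y -> local v x ->
  [/\ src a = v, link a \notin X & local (dst a) y].
Proof.
elim=> {x a y}; try by move=> *; auto.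
- by move=> i j a b y _ av _ _ jT _ IH _; apply/IH/local_bounce.
- by move=> j a nX [aD <-]; rewrite /= src_next_tour // next_mem_tour.
- move=> j a aX [aD <-]; rewrite src_flip; split=> //.
  by rewrite /= mem_prev aD dst_flip dst_prev_tour.
- by move=> j i a b y _ _ _ _ IH _; apply: IH.
- by move=> j a b y _ _ _ IH _; apply: IH.
Qed.

(** In a local state every link inspected is incident to [v], and changes of state without a hop
    stay local. *)
Lemma step_agree X Y v p x a y :
  (forall b, src b = v \/ dst b = v -> (link b \in Y) = (link b \in X)) ->
  step v p X x a y -> local v x -> step v p Y x a y.
Proof.
move=> XY; elim=> {x a y}.
- by move=> i a aT av aX _; apply: CanonicalHop; rewrite // XY; auto.
- move=> i j a b y aT av aX ji jT _ IH _.
  apply: (CanonicalBounce (j := j) aT av); rewrite // ?XY; auto.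
  exact/IH/local_bounce.
- move=> i a b y aT av aX none _ IH _.
  by apply: (CanonicalSkip aT av); [rewrite XY; auto|exact: none|exact: IH].
- by move=> j a nX [aD av]; apply: ForwardHop; rewrite XY // src_next_tour; auto.
- move=> j a b y nX _ IH [aD av].
  by apply: ForwardFail; [rewrite XY // src_next_tour|exact: IH]; auto.
- by move=> j a aX [aD av]; apply: BackwardHop; rewrite XY; auto.
- move=> j i a b y aX ij iT _ IH [aD av].
  by apply: BackwardFound ij iT _; [rewrite XY; auto|exact: IH].
- move=> j a b y aX none _ IH [aD av].
  by apply: BackwardLost; [rewrite XY; auto|exact: none|exact: IH].
Qed.

(** A node has at most one outgoing arc in each arborescence, and by disjointness at most one
    arborescence contains its flip; the other alternatives differ in whether a link is down. *)
Lemma step_functional X v p x0 a0 y0 b z :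
  step v p X x0 a0 y0 -> step v p X x0 b z -> a0 = b /\ y0 = z.
Proof.
have det i c d : c \in T i -> d \in T i -> src c = v -> src d = v -> c = d.
  by move=> cT dT cv dv; apply: (out_arc_unique (T_arb i)); rewrite // cv.
move=> h; elim: h b z => [i a aT av aX|i j a c y aT av aX ji jT _ IH
  |i a c y aT av aX none _ IH|j a nX|j a c y nX _ IH|j a aX
  |j i a c y aX ij iT _ IH|j a c y aX none _ IH] b z;
  move EX: (X in step _ _ _ X) => x h; case: x b z / h EX => //.
- by move=> i' a' aT' av' aX' [E]; rewrite E in aT *; rewrite (det _ _ _ aT aT').
- move=> i' j' a' b z aT' av' aX' _ _ _ [E]; rewrite E in aT *.
  by rewrite -(det _ _ _ aT aT') // (negPf aX) in aX'.
- move=> i' a' b z aT' av' aX' _ _ [E]; rewrite E in aT *.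
  by rewrite -(det _ _ _ aT aT') // (negPf aX) in aX'.
- move=> i' a' aT' av' aX' [E]; rewrite E in aT *.
  by rewrite -(det _ _ _ aT aT') // aX in aX'.
- move=> i' j' a' b z aT' av' aX' ji' jT' h [E]; rewrite E in aT *.
  rewrite -(det _ _ _ aT aT') // in jT' h.
  by rewrite -(arborescence_unique jT jT') in h; apply: IH h.
- move=> i' a' b z aT' av' aX' none h [E]; rewrite E in aT ji *.
  by have := none _ ji; rewrite -(det _ _ _ aT aT') // jT.
- move=> i' a' aT' av' aX' [E]; rewrite E in aT *.
  by rewrite -(det _ _ _ aT aT') // aX in aX'.
- move=> i' j' a' b z aT' av' aX' ji' jT' h [E]; rewrite E in aT none *.
  by have := none _ ji'; rewrite (det _ _ _ aT aT') // jT'.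
- by move=> i' a' b z aT' av' aX' none' h [E]; rewrite -E in h; apply: IH h.
- by move=> j' a' _ [-> ->].
- by move=> j' a' b z nX' _ [Ej Ea]; rewrite Ej Ea nX' in nX.
- by move=> j' a' nX' [Ej Ea]; rewrite -Ej -Ea nX in nX'.
- by move=> j' a' b z nX' h [Ej Ea]; rewrite -Ej -Ea in h; apply: IH h.
- by move=> j' a' _ [-> ->].
- by move=> j' i' a' b z aX' _ _ _ [_ Ea]; rewrite Ea aX' in aX.
- by move=> j' a' b z aX' _ _ [_ Ea]; rewrite Ea aX' in aX.
- by move=> j' a' aX' [_ Ea]; rewrite -Ea aX in aX'.
- move=> j' i' a' b z aX' _ iT' h [_ Ea]; rewrite -Ea in iT'.
  by rewrite -(arborescence_unique iT iT') in h; apply: IH h.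
- move=> j' a' b z aX' none _ [Ej Ea]; rewrite -Ej -Ea in none.
  by have := none _ ij; rewrite iT.
- by move=> j' a' aX' [_ Ea]; rewrite -Ea aX in aX'.
- move=> j' i' a' b z aX' ij iT _ [Ej Ea]; rewrite -Ej -Ea in ij iT.
  by have := none _ ij; rewrite iT.
- by move=> j' a' b z aX' _ h [Ej Ea]; rewrite -Ej -Ea in h; apply: IH h.
Qed.

(** * The header bits *)

Section Encoding.
Variable i1 : 'I_k.

(* The in-port [a] together with one bit, telling whether [a] or [flip a] is the
   arc of the tree, determines the tree that is traversed. *)
Definition encode (p : option (arc_of G)) x : 3.-tuple bool :=
  match p, x with
  | Some a, Forward j _ => [tuple true; false; a \in T j]
  | Some a, Backward j _ => [tuple true; true; a \in T j]
  | _, _ => nseq_tuple 3 false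
  end.

Definition tree_of a (o : bool) :=
  odflt i1 [pick j | (if o then a else flip a) \in T j].

(** In backward mode, arriving over [a] means that [flip a] has just been undone, so its predecessor
    in the tour is next. *)
Definition decode (p : option (arc_of G)) (h : 3.-tuple bool) : hdr_state G k :=
  match p, val h with
  | Some a, [:: false; _; _] => Canonical _ (tree_of a true)
  | Some a, [:: true; false; o] => Forward (tree_of a o) a
  | Some a, [:: true; true; o] =>
      Backward (tree_of a o) (prev (D (tree_of a o)) (flip a))
  | _, _ => Canonical _ i1
  end.

(** The relation between state and in-port that makes the encoding reversible. *)
Definition arrived (p : option (arc_of G)) x : Prop :=
  match p, x with
  | None, Canonical i => i = i1
  | Some a, Canonical i => a \in T i
  | Some a, Forward j b => a = b /\ a \in D j
  | Some a, Backward j b => flip a \in D j /\ b = prev (D j) (flip a)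
  | None, _ => False
  end.

Lemma step_arrived X v p x a y :
  step v p X x a y -> local v x -> arrived (Some a) y.
Proof.
elim=> {x a y} //.
- by move=> i j a b y _ av _ _ jT _ IH _; apply/IH/local_bounce.
- by move=> j a _ [aD _]; rewrite /= next_mem_tour.
- by move=> j a _ [aD _]; rewrite /= flipK.
- by move=> j i a b y _ _ _ _ IH _; apply: IH.
- by move=> j a b y _ _ _ IH _; apply: IH.
Qed.

Lemma tree_ofE a j o :
  (if o then a else flip a) \in T j -> tree_of a o = j.
Proof.
rewrite /tree_of; case: pickP => [i iT jT|/(_ j) -> //].
exact: arborescence_unique iT jT.
Qed.

Lemma tree_of_tour a j : (a \in D j) || (flip a \in D j) -> tree_of a (a \in T j) = j.
Proof.
move=> h; apply: tree_ofE; case: ifP => // aT; move: h.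
by rewrite !mem_tour flipK aT /= orbF orbb.
Qed.

Lemma encodeK p x : arrived p x -> decode p (encode p x) = x.
Proof.
case: p x => [a|] [i|j b|j b] //=.
- by move=> aT; rewrite /decode /= (@tree_ofE a i).
- by case=> <- aD; rewrite /decode /= tree_of_tour ?aD.
- by case=> aD ->; rewrite /decode /= tree_of_tour ?aD ?orbT.
- by move=> ->.
Qed.

(** * The forwarding function *)

(** Only the active incident links [A] are known, so all others count as down; those not incident to
    [v] are never inspected in a local state. *)
Definition forwards v p (A : {set edge G}) h (o : option (arc_of G * 3.-tuple bool)) :=
  match o with
  | Some (a, h') =>
      exists2 y, step v p (~: A) (decode p h) a y & h' = encode (Some a) y
  | None => forall a y, ~ step v p (~: A) (decode p h) a y
  end.

(** The rule is a relation that may allow no hop: the choice operator picks a hop if there is one,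
    and [None] otherwise. *)
Definition hdr_routing : routing G 3 := fun v p A h =>
  epsilon (inhabits None) (forwards v p A h).

Lemma hdr_routingP v p A h : forwards v p A h (hdr_routing v p A h).
Proof.
apply: epsilon_spec.
case: (classic (exists a y, step v p (~: A) (decode p h) a y)) => [[a [y st]]|none].
  by exists (Some (a, encode (Some a) y)); exists y.
by exists None => a y st; apply: none; exists a, y.
Qed.

Lemma active_links_incident X v a : src a = v \/ dst a = v ->
  (link a \in active_links v X) = (link a \notin X).
Proof.
move=> av; rewrite !inE; suff -> : ((ends (link a)).1 == v) || ((ends (link a)).2 == v).
  by rewrite andbT.
by case: a av => e [] [] <-; rewrite /src /dst /= eqxx ?orbT.
Qed.

Lemma step_active X v p x a y : local v x ->
  step v p (~: active_links v X) x a y <-> step v p X x a y.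
Proof.
move=> lx; split=> st; apply: step_agree st lx => b bv;
  by rewrite inE active_links_incident // negbK.
Qed.

(** Determinism of the rule identifies the chosen hop with the given one. *)
Lemma routing_step X v p x a y : local v x -> arrived p x ->
  step v p X x a y ->
  routing_rule hdr_routing v p X (encode p x) a (encode (Some a) y).
Proof.
move=> lx px st; have [av aX _] := step_local st lx.
split=> //; last by rewrite active_links_incident; auto.
have := hdr_routingP v p (active_links v X) (encode p x).
rewrite /forwards encodeK //; case: hdr_routing => [[b h']|none].
  case=> z /(step_active _ _ _ _ lx) st' ->.
  by have [-> ->] := step_functional st st'.
by case: (none a y); apply/step_active.
Qed.

Lemma step_routing X v p x a h : local v x -> arrived p x ->
  routing_rule hdr_routing v p X (encode p x) a h ->
  exists2 y, step v p X x a y & h = encode (Some a) y.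
Proof.
move=> lx px [E _ _].
have := hdr_routingP v p (active_links v X) (encode p x).
by rewrite E /= encodeK // => -[y /(step_active _ _ _ _ lx) st ->]; exists y.
Qed.

Lemma hdr_run_invariant down s n v p x :
  hdr_run T D dflt i1 t down s n v p x -> local v x /\ arrived p x.
Proof.
elim=> {n v p x} // n v p x a y _ [lx _] _ st.
by split; [case: (step_local st lx)|apply: step_arrived st lx].
Qed.

Lemma hdr_routing_run down s n v p x : hdr_run T D dflt i1 t down s n v p x ->
  routing_run hdr_routing t down s n v p (encode p x).
Proof.
elim=> {n v p x} [|n v p x a y r IH vt st]; first exact: RunStart.
have [lx px] := hdr_run_invariant r.
exact: RunHop IH vt (routing_step lx px st).
Qed.

Lemma routing_run_hdr down s n v p h :
  routing_run hdr_routing t down s n v p h ->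
  exists2 x, hdr_run T D dflt i1 t down s n v p x & h = encode p x.
Proof.
elim=> {n v p h} [|n v p h a h' _ [x r ->] vt st].
  by exists (Canonical _ i1) => //; exact: RunStart.
have [lx px] := hdr_run_invariant r; have [y st' ->] := step_routing lx px st.
by exists y => //; exact: RunHop r vt st'.
Qed.

Lemma hdr_routing_implements : implements_hdr T D dflt hdr_routing i1 t.
Proof.
move=> down s n v p; split=> [[x /hdr_routing_run r]|[h /routing_run_hdr [x r _]]].
  by exists (encode p x).
by exists x.
Qed.

End Encoding.

End HDR.

Theorem theorem11 (G : multigraph) (k : nat) (k_gt0 : 0 < k)
    (G_conn : k_edge_connected G k) (t : vertex G)
    (T : 'I_k -> {set arc_of G})
    (T_arb : forall i, arborescence t (T i))
    (T_disj : arc_disjoint T)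
    (D : 'I_k -> seq (arc_of G))
    (D_dfs : forall i, dfs_tour (T i) t (D i))
    (dflt : 'I_k -> arc_of G -> 'I_k) :
  exists R : routing G 3,
    implements_hdr T D dflt R (Ordinal k_gt0) t /\ resilient R t (k - 1).
Proof.
exists (hdr_routing T D dflt (Ordinal k_gt0)).
split; first exact: hdr_routing_implements.
move=> F Fk down down_F s _; have {}Fk : #|F| < k by rewrite -(subnK k_gt0) addn1.
have [n [p [x r]]] :=
  hdr_run_delivered dflt T_arb T_disj D_dfs (Ordinal k_gt0) s Fk down_F.
by exists n, p, (encode T p x); apply: hdr_routing_run r.
Qed.
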